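(* (a) Let $m\ge2$ and let $T$ be a triangulation of a convex $m$-gon with vertices $1,\dots,m$ in counterclockwise order, equipped with an admissible labelling $(a_t)_{t\in T}$. For each vertex $i$ let $c_i$ be the sum of the labels $a_t$ of the triangles $t$ having $i$ as a vertex. Then $(c_1,\dots,c_m)$ is a quiddity cycle over $\mathbb{Z}$. (b) Every quiddity cycle over $\mathbb{Z}$ arises as in (a) from some triangulation with an admissible labelling.
   Context: $\eta(c)=\begin{pmatrix}c&-1\\1&0\end{pmatrix}$. A quiddity cycle over $\mathbb{Z}$ is $(c_1,\dots,c_m)\in\mathbb{Z}^m$ with $\eta(c_1)\cdots\eta(c_m)=-I$. A triangulation of an $m$-gon is a subdivision into $m-2$ triangles by non-crossing diagonals; for $m=2$ it has no triangles. A labelling of a triangulation $T$ assigns an integer $a_t$ to each triangle $t\in T$. Let $d$ be the number of negative labels plus half the number of labels equal to $0$; if $d$ is an integer, the sign of the labelling is $(-1)^d$. A labelling is admissible if: (i) the set of triangles $t$ with $a_t\notin\{1,-1\}$ is a disjoint union of two-element sets $\{t_1,t_2\}$ (''squares'') with $t_1,t_2$ sharing an edge and $a_{t_1}=-a_{t_2}$; (ii) its sign is $1$, i.e. $d$ is an even integer. *)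

(* Defs.v *)
From HB Require Import structures.
From mathcomp Require Import all_boot all_order all_algebra.
Set Implicit Arguments. Unset Strict Implicit. Unset Printing Implicit Defensive.
Import Order.TTheory GRing.Theory Num.Theory.

Local Open Scope ring_scope.

Definition eta (c : int) : 'M[int]_2 :=
  \matrix_(i < 2, j < 2)
    (if (i == 0 :> nat) && (j == 0 :> nat) then c
     else if (i == 0 :> nat) then -1
     else if (j == 0 :> nat) then 1 else 0).

Definition quiddity_cycle (m : nat) (c : 'I_m -> int) : Prop :=
  \prod_(i < m) eta (c i) = - 1%:M.

Local Close Scope ring_scope.

(* Vertices of the convex m-gon are 0, ..., m-1 in counterclockwise order
   (vertex k here is vertex k+1 of the paper). *)

(* The chords {a,b} and {c,d} (a <> b, c <> d) cross in their interiors: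
   c, d are not endpoints of {a,b}, and exactly one of them lies strictly
   between a and b in the cyclic order. *)
Definition chords_cross (m : nat) (a b c d : 'I_m) : bool :=
  let inside x := (minn a b < x < maxn a b)%N in
  [&& a != b, c != d, c \notin [:: a; b], d \notin [:: a; b] & inside c != inside d].

Definition triangulation (m : nat) (T : {set {set 'I_m}}) : Prop :=
  [/\ (forall t, t \in T -> #|t| = 3),
      #|T| = (m - 2)%N
    & forall t1 t2, t1 \in T -> t2 \in T ->
        forall a b c d, a \in t1 -> b \in t1 -> c \in t2 -> d \in t2 ->
          ~~ chords_cross a b c d].

(* A labelling assigns an integer a t to each triangle (values off T are
   irrelevant). *)

(* 2 * d, where d = #negative labels + (#zero labels)/2. *)
Definition twice_d (m : nat) (T : {set {set 'I_m}}) (a : {set 'I_m} -> int) : nat :=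
  (2 * #|[set t in T | (a t < 0)%R]| + #|[set t in T | a t == 0%R]|)%N.

Definition sign_defined m T a : bool := ~~ odd (@twice_d m T a).
Definition labelling_sign m T a : int := ((-1) ^+ (@twice_d m T a)./2)%R.

Definition admissible (m : nat) (T : {set {set 'I_m}}) (a : {set 'I_m} -> int) : Prop :=
  (* (i) the triangles with label not in {1,-1} are partitioned into squares *)
  (exists P : {set {set {set 'I_m}}},
      partition P [set t in T | a t \notin [:: 1%R; (-1)%R]] /\
      forall B, B \in P -> exists t1 t2,
        [/\ B = [set t1; t2], t1 != t2, #|t1 :&: t2| = 2 & a t1 = (- a t2)%R])
  /\ (sign_defined T a /\ labelling_sign T a = 1%R).

Definition vertex_sum (m : nat) (T : {set {set 'I_m}}) (a : {set 'I_m} -> int) (i : 'I_m) : int :=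
  (\sum_(t in T | i \in t) a t)%R.

(* Main.v *)
Require Import Defs.
From HB Require Import structures.
From mathcomp Require Import all_boot all_order all_algebra zify ring.
Set Implicit Arguments. Unset Strict Implicit. Unset Printing Implicit Defensive.
Import Order.TTheory GRing.Theory Num.Theory.

(** A labelled triangulation of the polygon on an interval [i, j] of vertices is a labelled binary
    tree: the root is the triangle i < k < j on the side {i, j}, and its subtrees triangulate [i, k]
    and [k, j]. Write J = eta 0 and U_x = [[1, x], [0, 1]], so that eta x = U_x J. The product
    U_(c_i) J ... J U_(c_j) over the vertex sums c of a tree with root label x equals
    U_x L U_x R U_x, where L and R are the same products for the subtrees. Since
    U_x J U_x J U_x = x J for x = 1, -1 and a square contributes - J for the three leaf factors J, an
    admissible labelling of sign s gives s J, and s J J = - s.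

    In a triangulation, two non-crossing triangles cannot have the same middle vertex, so by
    counting each of the m - 2 inner vertices is the middle of exactly one triangle; growing a
    triangle at its outer vertices then reaches the side {0, m - 1}, and recursively yields the tree.

    Conversely, the (1, 1) entry of eta c_1 ... eta c_m = +- 1 forces a continuant of the inner
    entries to be +- 1, which is impossible if all of them have absolute value at least 2. So some
    inner entry is 1, -1 or 0: it can be removed as an ear, or as part of a square, and re-glued
    at a leaf of the tree obtained by induction. *)

Local Notation eta := Defs.eta.

(** * Labelled trees and their matrices *)

Inductive tree := Leaf | Node of int & tree & tree.

Fixpoint leaves t := if t is Node _ l r then leaves l + leaves r else 1.

Local Open Scope ring_scope.

(* Vertex [v]'s sum of labels, when the tree triangulates the vertices [i .. i + leaves t]. *)
Fixpoint tree_sum t (i v : nat) : int :=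
  if t is Node x l r then
    let k := (i + leaves l)%N in let j := (k + leaves r)%N in
    (if v \in [:: i; k; j] then x else 0) + tree_sum l i v + tree_sum r k v
  else 0.

(* The boolean is true when the labelling has sign -1. *)
Inductive adm_tree : tree -> bool -> Prop :=
| AdmLeaf : adm_tree Leaf false
| AdmNode x l r e1 e2 e of x \in [:: 1; -1] & adm_tree l e1 & adm_tree r e2
    & e = e1 (+) e2 (+) (x == -1) : adm_tree (Node x l r) e
| AdmSquareL x t1 t2 t3 e1 e2 e3 e of x \notin [:: 1; -1] & adm_tree t1 e1
    & adm_tree t2 e2 & adm_tree t3 e3 & e = ~~ (e1 (+) e2 (+) e3) :
    adm_tree (Node x (Node (- x) t1 t2) t3) e
| AdmSquareR x t1 t2 t3 e1 e2 e3 e of x \notin [:: 1; -1] & adm_tree t1 e1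
    & adm_tree t2 e2 & adm_tree t3 e3 & e = ~~ (e1 (+) e2 (+) e3) :
    adm_tree (Node x t1 (Node (- x) t2 t3)) e.

Lemma leaves_gt0 t : (0 < leaves t)%N.
Proof. by elim: t => //= x l Hl r Hr; rewrite addn_gt0 Hl. Qed.

Lemma tree_sum_lt t i v : (v < i)%N -> tree_sum t i v = 0.
Proof.
elim: t i => //= x l IHl r IHr i vi; rewrite IHl ?IHr ?addr0; [|lia|lia].
by case: ifP => //; rewrite !inE; lia.
Qed.

Lemma tree_sum_gt t i v : (i + leaves t < v)%N -> tree_sum t i v = 0.
Proof.
elim: t i => //= x l IHl r IHr i vi; rewrite IHl ?IHr ?addr0; [|lia|lia].
by case: ifP => //; rewrite !inE; lia.
Qed.

(** * Two-by-two integer matrices *)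

Lemma mulmx2E (A B : 'M[int]_2) i j : (A * B) i j = A i 0 * B 0 j + A i 1 * B 1 j.
Proof. by rewrite mxE !big_ord_recl big_ord0 addr0; congr (_ * _ + A _ _ * B _ _); apply: val_inj. Qed.

Definition mx2 (a b c d : int) : 'M[int]_2 :=
  \matrix_(i < 2, j < 2) (if i == 0 then if j == 0 then a else b else if j == 0 then c else d).

Definition shear (x : int) := mx2 1 x 0 1.

Lemma etaE x : eta x = mx2 x (-1) 1 0.
Proof.
by apply/matrixP=> i j; rewrite !mxE; case: i j => [[|[|]]] // ? [[|[|]]].
Qed.

Lemma one_mx2 : 1 = mx2 1 0 0 1.
Proof.
by apply/matrixP=> i j; rewrite !mxE; case: i j => [[|[|]]] // ? [[|[|]]].
Qed.

Lemma mulmx2 a b c d a' b' c' d' : mx2 a b c d * mx2 a' b' c' d' =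
  mx2 (a * a' + b * c') (a * b' + b * d') (c * a' + d * c') (c * b' + d * d').
Proof.
apply/matrixP=> i j; rewrite mulmx2E !mxE.
by case: i j => [[|[|]]] // ? [[|[|]]].
Qed.

Lemma oppmx2 a b c d : - mx2 a b c d = mx2 (- a) (- b) (- c) (- d).
Proof.
by apply/matrixP=> i j; rewrite !mxE; case: i j => [[|[|]]] // ? [[|[|]]].
Qed.

Local Ltac mx2_ring := rewrite ?etaE /shear ?one_mx2 ?(mulmx2, oppmx2); congr mx2; ring.

Lemma shear0 : shear 0 = 1. Proof. mx2_ring. Qed.
Lemma shearD x y : shear (x + y) = shear x * shear y. Proof. mx2_ring. Qed.
Lemma eta_shear x : eta x = shear x * eta 0. Proof. mx2_ring. Qed.
Lemma eta0_sq : eta 0 * eta 0 = -1. Proof. mx2_ring. Qed.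

(** The last factor lacks its [eta 0], so the product begins and ends with a shear; two such
    products can then be glued at a shared vertex. *)
Fixpoint path_mx (f : nat -> int) i n :=
  if n is n'.+1 then shear (f i) * eta 0 * path_mx f i.+1 n' else shear (f i).

Lemma eq_path_mx f g i n : (forall v, (i <= v <= i + n)%N -> f v = g v) ->
  path_mx f i n = path_mx g i n.
Proof.
elim: n i => [|n IHn] i fg /=; rewrite fg ?leqnn ?leq_addr //.
by rewrite (IHn i.+1) // => v iv; apply: fg; lia.
Qed.

Lemma path_mx_addl f g x i n : f i = x + g i -> (forall v, (i < v)%N -> f v = g v) ->
  path_mx f i n = shear x * path_mx g i n.
Proof.
case: n => [|n] /= fi fg; rewrite fi shearD // -!mulrA.
by congr (_ * (_ * (_ * _))); apply: eq_path_mx => v iv; apply: fg; lia.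
Qed.

(** Shears are additive, so the shear at the shared vertex [i + n1] factors into the last shear of
    one part and the first shear of the other. *)
Lemma path_mx_split f g h i n1 n2 :
  (forall v, (v < i + n1)%N -> f v = g v) -> (forall v, (i + n1 < v)%N -> f v = h v) ->
  f (i + n1)%N = g (i + n1)%N + h (i + n1)%N ->
  path_mx f i (n1 + n2) = path_mx g i n1 * path_mx h (i + n1)%N n2.
Proof.
elim: n1 i => [|n1 IHn] i fg fh fk /=.
  rewrite addn0 in fk *.
  by apply: path_mx_addl => // v iv; apply: fh; lia.
rewrite fg; last lia.
by rewrite (IHn i.+1) ?addSnnS ?mulrA // => v iv; apply: fg; lia.
Qed.

Lemma path_mx_addr f g x i n : f (i + n)%N = g (i + n)%N + x -> (forall v, (v < i + n)%N -> f v = g v) ->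
  path_mx f i n = path_mx g i n * shear x.
Proof.
move=> fi fg; pose h v := if v == (i + n)%N then x else f v.
rewrite -[in LHS](addn0 n) (@path_mx_split f g h) /= /h ?eqxx // => v iv.
by case: eqP => //; lia.
Qed.

Lemma path_mx_node x l r i :
  path_mx (tree_sum (Node x l r) i) i (leaves (Node x l r)) =
  shear x * path_mx (tree_sum l i) i (leaves l) * shear x *
  path_mx (tree_sum r (i + leaves l)) (i + leaves l) (leaves r) * shear x.
Proof.
have lp := leaves_gt0 l; have rp := leaves_gt0 r.
set k := (i + leaves l)%N; set j := (k + leaves r)%N.
(* The root label occurs at [i], [k] and [j]; its copy at the shared vertex [k] is credited to the
   right-hand part [h]. *)
pose g v := (if v == i then x else 0) + tree_sum l i v.
pose h1 v := tree_sum r k v + (if v == j then x else 0).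
pose h v := (if v == k then x else 0) + h1 v.
rewrite [leaves _]/= (@path_mx_split _ g h).
- rewrite (@path_mx_addl g (tree_sum l i) x) ?(@path_mx_addl h h1 x)
    ?(@path_mx_addr h1 (tree_sum r k) x) /h1 /h /g ?eqxx ?mulrA // => v vi;
  by case: eqP => [|_]; rewrite ?add0r ?addr0 //; lia.
- move=> v vi; rewrite /g /h /h1 /= (tree_sum_lt r) ?addr0 // !inE.
  by congr (_ + _); case: ifP; case: ifP => //; lia.
- move=> v vi; rewrite /g /h /h1 /= (tree_sum_gt (t:=l)) ?addr0 // !inE -/j -/k.
  rewrite [tree_sum r k v + _]addrC addrA; congr (_ + _).
  by do !case: ifP; rewrite ?addr0 ?add0r //; lia.
rewrite /g /h /h1 /= !inE -/j -/k eqxx orbT.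
have -> : (k == i) = false by lia.
have -> : (k == j) = false by lia.
by rewrite add0r addr0 addrCA addrA.
Qed.

Lemma triangle_mx x : x \in [:: 1; -1] ->
  shear x * eta 0 * shear x * eta 0 * shear x = (-1) ^+ (x == -1) * eta 0.
Proof. by rewrite !inE => /orP[] /eqP->; rewrite ?expr0 ?expr1; mx2_ring. Qed.

Lemma squareL_mx x : shear x * (shear (- x) * eta 0 * shear (- x) * eta 0 * shear (- x)) *
  shear x * eta 0 * shear x = - eta 0.
Proof. mx2_ring. Qed.

Lemma squareR_mx x : shear x * eta 0 * shear x *
  (shear (- x) * eta 0 * shear (- x) * eta 0 * shear (- x)) * shear x = - eta 0.
Proof. mx2_ring. Qed.

Lemma adm_tree_path_mx t e i : adm_tree t e ->
  path_mx (tree_sum t i) i (leaves t) = (-1) ^+ e * eta 0.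
Proof.
move=> te; elim: te i => {t e} [|x l r e1 e2 e xP _ IH1 _ IH2 ->
  |x t1 t2 t3 e1 e2 e3 e _ _ IH1 _ IH2 _ IH3 ->
  |x t1 t2 t3 e1 e2 e3 e _ _ IH1 _ IH2 _ IH3 ->] i.
- by rewrite /= shear0 mulr1.
- rewrite path_mx_node IH1 IH2 !signr_addb -!mulrA -triangle_mx // -!mulrA.
  by case: e1 {IH1}; case: e2 {IH2}; rewrite ?expr0 ?expr1 ?(mul1r, mulN1r, mulrN, mulNr, opprK).
- have := squareL_mx x; rewrite !path_mx_node IH1 IH2 IH3 -!mulrA => sq.
  by case: e1 {IH1}; case: e2 {IH2}; case: e3 {IH3};
    rewrite ?expr0 ?expr1 ?(mul1r, mulN1r, mulrN, mulNr, opprK) sq ?opprK.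
- have := squareR_mx x; rewrite !path_mx_node IH1 IH2 IH3 -!mulrA => sq.
  by case: e1 {IH1}; case: e2 {IH2}; case: e3 {IH3};
    rewrite ?expr0 ?expr1 ?(mul1r, mulN1r, mulrN, mulNr, opprK) sq ?opprK.
Qed.

Lemma prod_eta f i n : \prod_(v < n.+1) eta (f (v + i)%N) = path_mx f i n * eta 0.
Proof.
elim: n i => [|n IHn] i; rewrite big_ord_recl /= eta_shear; first by rewrite big_ord0 mulr1.
rewrite -!mulrA -IHn; congr (_ * (_ * _)); apply: eq_bigr => v _.
by rewrite addSnnS.
Qed.

(** * Grafting a tree onto a leaf *)

Fixpoint graft t p t' :=
  if t is Node x l r then
    if (p < leaves l)%N then Node x (graft l p t') r
    else Node x l (graft r (p - leaves l)%N t')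
  else t'.

(** An index [p] past the end descends to the last leaf, so exactly one leaf is replaced for every
    [p]. *)
Lemma leaves_graft t p t' : leaves (graft t p t') = (leaves t + leaves t').-1%N.
Proof.
have h s := leaves_gt0 s.
elim: t p => //= x l IHl r IHr p.
have := h l; have := h r.
case: ifP => _ /=; rewrite ?IHl ?IHr; lia.
Qed.

(** A leaf below a square lies in one of its three subtrees, so grafting never separates the two
    triangles of a square. *)
Lemma adm_graft t p t' e e' : adm_tree t e -> adm_tree t' e' ->
  adm_tree (graft t p t') (e (+) e').
Proof.
move=> te te'; elim: te p => {t e} [|x l r e1 e2 e xP a1 IH1 a2 IH2 ->
  |x t1 t2 t3 e1 e2 e3 e xP a1 IH1 a2 IH2 a3 IH3 ->
  |x t1 t2 t3 e1 e2 e3 e xP a1 IH1 a2 IH2 a3 IH3 ->] p //=.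
- by case: ifP => _; [apply: (AdmNode xP (IH1 _) a2)|apply: (AdmNode xP a1 (IH2 _))];
  case: e1 {a1 IH1}; case: e2 {a2 IH2}; case: (e'); case: eqP.
- do !case: ifP => _; [apply: (AdmSquareL xP (IH1 _) a2 a3)|
    apply: (AdmSquareL xP a1 (IH2 _) a3)|apply: (AdmSquareL xP a1 a2 (IH3 _))];
  by case: e1 {a1 IH1}; case: e2 {a2 IH2}; case: e3 {a3 IH3}; case: (e').
- do !case: ifP => _; [apply: (AdmSquareR xP (IH1 _) a2 a3)|
    apply: (AdmSquareR xP a1 (IH2 _) a3)|apply: (AdmSquareR xP a1 a2 (IH3 _))];
  by case: e1 {a1 IH1}; case: e2 {a2 IH2}; case: e3 {a3 IH3}; case: (e').
Qed.

Lemma tree_sum_shift t i d v : tree_sum t (i + d) (v + d) = tree_sum t i v.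
Proof.
elim: t i => //= x l IHl r IHr i.
rewrite IHl (_ : i + d + leaves l = i + leaves l + d)%N ?IHr; last lia.
by congr (_ + _ + _); congr (if _ then _ else _); rewrite !inE; lia.
Qed.

(** Leaf [p] is the side from [i + p] to [i + p + 1]. Grafting inserts [leaves t' - 1] vertices
    there, which [t] does not touch; later vertices move up by this number, and [v.+1 - leaves t']
    moves them back. *)
Lemma tree_sum_graft t p t' i v : (p < leaves t)%N ->
  tree_sum (graft t p t') i v =
  (if (v <= i + p)%N then tree_sum t i v
   else if (v < i + p + leaves t')%N then 0 else tree_sum t i (v.+1 - leaves t'))
  + tree_sum t' (i + p) v.
Proof.
have h := leaves_gt0; have h' := h t'.
elim: t p i => [|x l IHl r IHr] p i /= pt.
  by rewrite (_ : p = 0)%N; [rewrite addn0; do !case: ifP; rewrite ?add0r|lia].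
have hl := h l; have hr := h r.
case: ifP => pl /=; rewrite leaves_graft.
  rewrite IHl // addrA [LHS]addrAC; congr (_ + _).
  pose d := (leaves t').-1.
  case: (leqP v (i + p)%N) => vp.
    rewrite !(@tree_sum_lt r) ?addr0; try lia.
    by congr (_ + _); congr (if _ then _ else _); rewrite !inE; lia.
  case: (ltnP v (i + p + leaves t')%N) => vp'.
    rewrite !(@tree_sum_lt r) ?addr0; try lia.
    by case: ifP => //; rewrite !inE; lia.
  congr (_ + _ + _).
    by congr (if _ then _ else _); rewrite !inE; lia.
  by rewrite -(tree_sum_shift r (i + leaves l) d); congr tree_sum; lia.
rewrite (IHr _ (i + leaves l)%N); last lia.
have -> : (i + leaves l + (p - leaves l) = i + p)%N by lia.
rewrite addrA; congr (_ + _).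
case: (leqP v (i + p)%N) => vp.
  by congr (_ + _ + _); congr (if _ then _ else _); rewrite !inE; lia.
case: (ltnP v (i + p + leaves t')%N) => vp'.
  rewrite (@tree_sum_gt l) ?addr0; try lia.
  by case: ifP => //; rewrite !inE; lia.
rewrite !(@tree_sum_gt l); try lia.
by congr (_ + _ + _); congr (if _ then _ else _); rewrite !inE; lia.
Qed.

(** * Reduction of quiddity cycles *)

(** Multiplying by [eta x] on the left turns a first column (p, q) into (x p - q, p). If |q| < |p|
    and |x| >= 2, then |x p - q| >= 2|p| - |q| > |p| >= 1. *)
Lemma eta_continuant_growth (s : seq int) : (forall x, x \in s -> 2 <= `|x|) ->
  let M := \prod_(x <- s) eta x in
  `|M 1 0| < `|M 0 0| /\ (s != [::] -> 2 <= `|M 0 0|).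
Proof.
elim: s => [|x s IHs] /= sP.
  by rewrite big_nil !mxE.
have [|lt10 _] := IHs; first by move=> y ys; apply: sP; rewrite inE ys orbT.
have x2 := sP x (mem_head _ _).
rewrite big_cons; set M := \prod_(y <- s) _ in lt10 *.
rewrite !mulmx2E !mxE /= mul1r mul0r addr0 mulN1r.
have step (p q r : int) : 2 * `|q| <= `|p| -> `|r| < `|q| -> `|q| < `|p - r| /\ 2 <= `|p - r| by lia.
have [] := step (x * M 0 0) _ _ _ lt10; first by rewrite normrM ler_wpM2r.
by split.
Qed.

(** The entry (1, 1), counted from 0, of the whole product is minus the top-left entry of the
    product over [s]. The latter is thus 1 or -1, against the growth that large entries would
    force. *)
Lemma eta_small_interior (a b : int) (s : seq int) (e : bool) : s != [::] ->
  \prod_(x <- a :: rcons s b) eta x = (-1) ^+ e -> exists2 x, x \in s & `|x| < 2.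
Proof.
move=> s0 prodE; apply/hasP/negPn/negP => /hasPn sP.
have {}sP x : x \in s -> 2 <= `|x| by move/sP; rewrite -leNgt.
have [_ /(_ s0)] := eta_continuant_growth sP.
move: prodE; rewrite -cats1 big_cons big_cat big_seq1 /=; set M := \prod_(x <- s) _.
move/matrixP/(_ 1 1); rewrite !mulmx2E !mxE /= => M00.
have M1 : `|M 0 0| = 1; last by rewrite M1.
move: M00; case: e; rewrite ?expr1 ?expr0 !mxE /=; lia.
Qed.

Lemma eta_ear (a b x : int) : x \in [:: 1; -1] ->
  eta (a - x) * eta (b - x) = (-1) ^+ (x == -1) * (eta a * eta x * eta b).
Proof. by rewrite !inE => /orP[] /eqP->; rewrite ?expr0 ?expr1; mx2_ring. Qed.

Lemma eta_0 (a b : int) : eta a * eta 0 * eta b = - eta (a + b).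
Proof. mx2_ring. Qed.

(** For [x] equal to 1 or -1 the two triangles count separately; exactly one of them has label -1,
    so the sign is that of a genuine square. *)
Lemma adm_squareL x : adm_tree (Node x (Node (- x) Leaf Leaf) Leaf) true.
Proof.
case: (boolP (x \in [:: 1; -1])) => xP; last exact: AdmSquareL xP AdmLeaf AdmLeaf AdmLeaf _.
have a1 : adm_tree (Node (- x) Leaf Leaf) (- x == -1).
  by apply: AdmNode AdmLeaf AdmLeaf _; move: xP; rewrite !inE; lia.
apply: (AdmNode xP a1 AdmLeaf); move: xP; rewrite !inE; lia.
Qed.

Lemma adm_squareR x : adm_tree (Node x Leaf (Node (- x) Leaf Leaf)) true.
Proof.
case: (boolP (x \in [:: 1; -1])) => xP; last exact: AdmSquareR xP AdmLeaf AdmLeaf AdmLeaf _.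
have a1 : adm_tree (Node (- x) Leaf Leaf) (- x == -1).
  by apply: AdmNode AdmLeaf AdmLeaf _; move: xP; rewrite !inE; lia.
apply: (AdmNode xP AdmLeaf a1); move: xP; rewrite !inE; lia.
Qed.

Definition realizes t e s := [/\ adm_tree t e, size s = (leaves t).+1
    & forall v, (v < size s)%N -> nth 0 s v = tree_sum t 0 v].

Lemma nth_cat_lt (s1 s2 : seq int) v : (v < size s1)%N -> nth 0 (s1 ++ s2) v = nth 0 s1 v.
Proof. by rewrite nth_cat => ->. Qed.

Lemma nth_cat_ge (s1 s2 : seq int) v : nth 0 (s1 ++ s2) (size s1 + v) = nth 0 s2 v.
Proof. by rewrite nth_cat ltnNge leq_addr addKn. Qed.

(** The entries [a] and [b] sit at the ends of leaf number [size L]. They gain the sums of [t'] at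
    its two extreme vertices, and the inner vertices of [t'] come between them. *)
Lemma realizes_graft t e t' e' L a b R : adm_tree t' e' ->
  realizes t e (L ++ a :: b :: R) ->
  realizes (graft t (size L) t') (e (+) e') (L ++ a + tree_sum t' 0 0 ::
    [seq tree_sum t' 0 v.+1 | v <- iota 0 (leaves t').-1] ++
    b + tree_sum t' 0 (leaves t') :: R).
Proof.
move=> a' [te sz sE]; have h := leaves_gt0 t'; split; first exact: adm_graft.
  by move: sz; rewrite leaves_graft !size_cat /= size_cat size_map size_iota /=; lia.
move: sz sE; rewrite !size_cat /= size_cat size_map size_iota /= => sz sE v vs.
rewrite tree_sum_graft; last by lia.
have [vL|vL] := ltnP v (size L).
  rewrite nth_cat_lt // ifT ?(@tree_sum_lt t') ?addr0 ?add0n //; last exact: ltnW.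
  by rewrite -sE ?nth_cat_lt // ltn_addr.
rewrite -(subnKC vL) in vs *; move: (v - size L)%N vs => {vL}v vs.
have shift : tree_sum t' (size L) (size L + v) = tree_sum t' 0 v.
  by rewrite -[in RHS](tree_sum_shift _ _ (size L)) addnC.
rewrite nth_cat_ge add0n {}shift.
case: v vs => [|v] vs /=.
  by rewrite addn0 leqnn -sE ?[X in nth _ _ X](esym (addn0 (size L))) ?nth_cat_ge //; lia.
rewrite ifF; last by lia.
rewrite nth_cat size_map size_iota.
case: ltnP => vt.
  by rewrite (nth_map 0%N) ?size_iota // nth_iota // ifT ?add0r //; lia.
rewrite ifF; last by lia.
have -> : ((size L + v.+1).+1 - leaves t' = size L + (v.+1 - (leaves t').-1))%N by lia.
rewrite -sE ?nth_cat_ge; last by lia.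
(* First after the inserted entries comes [b], at the last vertex of [t']; all later vertices lie
   outside [t']. *)
rewrite subSn // /=; case E: (v - _)%N => [|w] /=.
  by congr (b + tree_sum t' 0 _); lia.
by rewrite tree_sum_gt ?addr0 //; lia.
Qed.

(** Both signs are treated at once, because removing an ear of label -1 or an entry 0 flips the
    sign. *)
Lemma quiddity_tree (s : seq int) (e : bool) : (0 < size s)%N ->
  \prod_(x <- s) eta x = - (-1) ^+ e -> exists t, realizes t e s.
Proof.
elim/ltn_ind: {s}(size s) {-2}s (erefl (size s)) e => n IHn s sz e.
case: s sz => [|c1 s] /= sz; first by [].
case/lastP: s sz => [|s cm] sz _ prodE.
  (* A single [eta c1] has lower-left entry 1, so it is neither I nor -I. *)
  move: prodE; rewrite big_seq1 => /matrixP/(_ 1 0); case: e; rewrite !mxE /=; lia.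
have [s0|s0] := eqVneq s [::].
  move: prodE; rewrite s0 /= big_cons big_seq1 => /matrixP h.
  have := h 0 0; have := h 0 1; have := h 1 0.
  rewrite !mulmx2E; case: e h => h; rewrite ?expr1 ?expr0 !mxE /= => h1 h2 h3; first by lia.
  exists Leaf; split => //=; first exact: AdmLeaf.
  by move=> [|[|v]] //= _; lia.
have prodE' : \prod_(x <- c1 :: rcons s cm) eta x = (-1) ^+ (~~ e).
  by rewrite prodE; case: (e); rewrite ?expr1 ?expr0 ?opprK.
have [x xs x2] := eta_small_interior s0 prodE'.
(* The neighbours [a] and [b] of [x] may be the outermost entries. *)
have [L [a [b [R sE]]]] : exists L a b R, c1 :: rcons s cm = rcons L a ++ x :: b :: R.
  case/splitPr: xs => s1 s2; rewrite rcons_cat -cat_cons lastI.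
  exists (belast c1 s1), (last c1 s1).
  by case: s2 => [|y s2]; [exists cm, [::] | exists y, (rcons s2 cm)].
move: (sz : size (c1 :: rcons s cm) = n) prodE; rewrite sE cat_rcons.
move=> {prodE' s0 xs s sE c1 cm sz}.
rewrite big_cat !big_cons !size_cat /= => sz prodE.
have [x0|x0] := eqVneq x 0; last first.
  (* The vertex of [x] is an ear: dropping it lowers both neighbours by [x], and grafting one
     triangle restores it. *)
  have xP : x \in [:: 1; -1] by rewrite !inE; lia.
  have [||||t tE] := IHn n.-1 _ (L ++ a - x :: b - x :: R) _ (e (+) (x == -1)).
  - by lia.
  - by rewrite size_cat /=; lia.
  - by rewrite size_cat /=; lia.
  - rewrite big_cat !big_cons /= signr_addb -mulNr -prodE (mulrA (eta _) (eta _)) eta_ear //.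
    by case: (x == -1); rewrite ?expr0 ?expr1 ?(mul1r, mulr1, mulN1r, mulrN1, mulNr, mulrN) !mulrA.
  exists (graft t (size L) (Node x Leaf Leaf)).
  have := realizes_graft (AdmNode xP AdmLeaf AdmLeaf erefl) tE.
  by rewrite /= !addr0 !subrK -addbA addbb addbF.
(* Now [x] is 0: the entries [a], 0, [b] merge into [a + b] at the cost of a sign, and a square will
   restore them. *)
rewrite {}x0 in prodE *; rewrite -[e]negbK -addTb addbC.
have {}prodE P : P = \prod_(y <- L) eta y ->
    P * (eta (a + b) * \prod_(y <- R) eta y) = - (-1) ^+ (~~ e).
  move=> ->; rewrite -[eta (a + b)]opprK -eta_0 mulNr mulrN -!mulrA prodE.
  by case: (e); rewrite ?expr0 ?expr1 ?opprK.
(* The square is glued to a side at the vertex of [a + b]: the one on its left if [L] is nonempty,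
   else the one on its right. *)
case/lastP: L sz prodE => [|L u].
  case: R => [|v R] sz prodE.
    (* Without a further vertex [eta (a + b)] would be I or -I, but its lower-left entry is 1. *)
    have /matrixP/(_ 1 0) := prodE 1 (esym (big_nil _ _ _ _)).
    by rewrite big_nil mul1r mulr1; case: (e); rewrite !mxE.
  have [||||t tE] := IHn n.-2 _ (a + b :: v :: R) _ (~~ e) => //=.
  - by move: sz => /=; lia.
  - by move: sz => /=; lia.
  - by rewrite big_cons -(prodE 1) ?mul1r // big_nil.
  (* This square has vertex sums -b, 0, b, 0, so it turns [a + b], [v] into [a], 0, [b], [v]. *)
  exists (graft t 0 (Node (- b) Leaf (Node (- - b) Leaf Leaf))).
  have := @realizes_graft _ _ _ _ [::] _ _ _ (adm_squareR (- b)) tE.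
  by rewrite /= !addr0 !add0r !subrr !opprK !addrK addr0.
rewrite size_rcons cat_rcons => sz prodE.
have [||||t tE] := IHn n.-2 _ (L ++ u :: a + b :: R) _ (~~ e).
- by lia.
- by rewrite size_cat /=; lia.
- by rewrite size_cat /=; lia.
- by rewrite -(prodE _ erefl) big_rcons /= big_cat !big_cons /= !mulrA.
(* This square has vertex sums 0, a, 0, -a, so it turns [u], [a + b] into [u], [a], 0, [b]. *)
exists (graft t (size L) (Node (- a) (Node (- - a) Leaf Leaf) Leaf)).
have := realizes_graft (adm_squareL (- a)) tE.
rewrite /= !addr0 !add0r !subrr !opprK addr0 [a + b]addrC addrK.
exact.
Qed.

Local Close Scope ring_scope.
Local Open Scope nat_scope.

(** * The triangulation of a tree *)

Lemma partitionUU (T : finType) (P Q : {set {set T}}) (D E : {set T}) :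
  partition P D -> partition Q E -> [disjoint D & E] -> partition (P :|: Q) (D :|: E).
Proof.
move=> /and3P[/eqP cP tP nP] /and3P[/eqP cQ tQ nQ] dDE; apply/and3P; split.
- by rewrite /cover bigcup_setU -/(cover P) -/(cover Q) cP cQ.
- rewrite /trivIset in tP tQ *.
  have PQ : [disjoint P & Q].
    apply/pred0P=> B /=; apply/negP=> /andP[BP BQ].
    have [B0|[x xB]] := set_0Vmem B; first by rewrite -B0 BP in nP.
    have /pred0P/(_ x) := dDE; rewrite /= -cP -cQ => /negP[].
    by apply/andP; split; apply/bigcupP; exists B.
  have -> : cover (P :|: Q) = D :|: E by rewrite /cover bigcup_setU -/(cover P) -/(cover Q) cP cQ.
  rewrite (eq_bigl (fun A => (A \in P) || (A \in Q))); last by move=> A; rewrite inE.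
  rewrite bigU //= (eqP tP) (eqP tQ) cP cQ cardsU.
  by move: dDE; rewrite -setI_eq0 => /eqP->; rewrite cards0 subn0.
- by rewrite inE negb_or nP.
Qed.

Section Polygon.
Variable m : nat.
Implicit Types (t : tree) (i j k v : nat).

Definition tri i j k : {set 'I_m} := [set v : 'I_m | (v : nat) \in [:: i; j; k]].

Fixpoint triangles t i : {set {set 'I_m}} :=
  if t is Node _ l r then
    let k := i + leaves l in
    tri i k (k + leaves r) |: (triangles l i :|: triangles r k)
  else set0.

Lemma card_tri i j k : i < j < k -> k < m -> #|tri i j k| = 3.
Proof.
move=> ijk km.
have im : i < m by lia. have jm : j < m by lia.
have -> : tri i j k = [set Ordinal im; Ordinal jm; Ordinal km].
  by apply/setP=> v; rewrite !inE -!val_eqE /= orbA.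
by rewrite setUC cardsU1 cards2 !inE -!val_eqE /=; lia.
Qed.

Lemma trianglesP t i T : T \in triangles t i ->
  exists a b c, [/\ T = tri a b c, i <= a, a < b, b < c & c <= i + leaves t].
Proof.
elim: t i => [|x l IHl r IHr] i /=; first by rewrite inE.
have hl := leaves_gt0 l; have hr := leaves_gt0 r.
rewrite !inE => /or3P[/eqP->|/IHl[a [b [c [-> ? ? ? ?]]]]|/IHr[a [b [c [-> ? ? ? ?]]]]].
- by exists i, (i + leaves l), (i + leaves l + leaves r); split=> //; lia.
- by exists a, b, c; split=> //; lia.
- by exists a, b, c; split=> //; lia.
Qed.

Lemma tri_inj a b c a' b' c' : a < b < c -> c < m -> a' < b' < c' -> c' < m ->
  tri a b c = tri a' b' c' -> [/\ a = a', b = b' & c = c'].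
Proof.
move=> abc cm abc' cm' /setP E.
have sub v : v < m -> v \in [:: a'; b'; c'] -> v \in [:: a; b; c].
  by move=> vm; have := E (Ordinal vm); rewrite !inE /= => ->.
move: (sub a') (sub b') (sub c'); rewrite !inE !eqxx !orbT.
have [am' bm'] : a' < m /\ b' < m by lia.
rewrite am' bm' cm' => /(_ isT isT) A /(_ isT isT) B /(_ isT isT) C.
by split; lia.
Qed.

(** The two subpolygons meet in the vertex [k] alone, and neither contains both ends of the base
    side, as the root triangle does. *)
Lemma triangles_node x l r i (n := leaves (Node x l r)) (k := i + leaves l) : i + n < m ->
  [disjoint triangles l i & triangles r k] /\
  tri i k (i + n) \notin triangles l i :|: triangles r k.
Proof.
have hl := leaves_gt0 l; have hr := leaves_gt0 r.
rewrite /n /= addnA -/k => nm; split.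
  apply/pred0P=> T; apply/negP=> /andP[/trianglesP[a [b [c [-> ? ? ? ?]]]]].
  move=> /trianglesP[a' [b' [c' [E ? ? ? ?]]]].
  by have [] := tri_inj _ _ _ _ E; lia.
rewrite inE; apply/norP; split; apply/negP=> /trianglesP[a [b [c [E ? ? ? ?]]]];
  by have [] := tri_inj _ _ _ _ E; lia.
Qed.

(** The general codomain serves label sums in [int] as well as cardinals and [twice_d] in [nat]. *)
Lemma big_triangles_node (R : nmodType) (F : {set 'I_m} -> R) x l r i
    (n := leaves (Node x l r)) (k := i + leaves l) : i + n < m ->
  (\sum_(T in triangles (Node x l r) i) F T =
   F (tri i k (i + n)) + (\sum_(T in triangles l i) F T + \sum_(T in triangles r k) F T))%R.
Proof.
move=> nm; have [dlr ntri] := triangles_node (x := x) nm.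
have E : i + n = k + leaves r by rewrite /n /= addnA.
rewrite [triangles _ _]/= -/k -E big_setU1 //=; congr (_ + _)%R.
rewrite -bigU //; apply: eq_bigl => T; by rewrite inE.
Qed.

Lemma card_triangles t i : i + leaves t < m -> #|triangles t i| = (leaves t).-1.
Proof.
elim: t i => [|x l IHl r IHr] i nm; first by rewrite /= cards0.
have hl := leaves_gt0 l; have hr := leaves_gt0 r.
rewrite -sum1_card (big_triangles_node (R := nat) _ nm) !sum1_card.
rewrite /= in nm *; rewrite IHl ?IHr; rewrite /GRing.add /=; lia.
Qed.

Lemma not_cross i k (a b c d : 'I_m) : i <= a <= k -> i <= b <= k ->
  ~~ (i < c < k) -> ~~ (i < d < k) -> ~~ chords_cross a b c d.
Proof. by rewrite /chords_cross !inE -!val_eqE /=; lia. Qed.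

Lemma not_cross_tri i k j (a b c d : 'I_m) : i < k < j ->
  (a : nat) \in [:: i; k; j] -> (b : nat) \in [:: i; k; j] ->
  [|| (i <= c <= k) && (i <= d <= k), (k <= c <= j) && (k <= d <= j)
    | ((c : nat) \in [:: i; k; j]) && ((d : nat) \in [:: i; k; j])] ->
  ~~ chords_cross a b c d.
Proof.
rewrite /chords_cross !inE -!val_eqE /=.
case: a b c d => [a am] [b bm] [c cm] [d dm] /=.
by move=> ikj /or3P[] /eqP-> /or3P[] /eqP-> H; lia.
Qed.

Lemma triangles_not_cross t i T1 T2 : i + leaves t < m ->
  T1 \in triangles t i -> T2 \in triangles t i ->
  forall a b c d, a \in T1 -> b \in T1 -> c \in T2 -> d \in T2 -> ~~ chords_cross a b c d.
Proof.
have bnd t' i' T (v : 'I_m) : T \in triangles t' i' -> v \in T -> i' <= v <= i' + leaves t'.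
  by move=> /trianglesP[a [b [c [-> ? ? ? ?]]]]; rewrite !inE; lia.
elim: t i => [|x l IHl r IHr] i /= nm; first by rewrite inE.
have hl := leaves_gt0 l; have hr := leaves_gt0 r.
rewrite !inE => /or3P[/eqP->|T1l|T1r] /or3P[/eqP->|T2l|T2r] a b c d.
- rewrite !inE => aT bT cT dT.
  apply: (@not_cross_tri i (i + leaves l) (i + leaves l + leaves r)); rewrite ?inE; lia.
- rewrite !inE => aT bT /(bnd _ _ _ _ T2l) cT /(bnd _ _ _ _ T2l) dT.
  apply: (@not_cross_tri i (i + leaves l) (i + leaves l + leaves r)); rewrite ?inE //; lia.
- rewrite !inE => aT bT /(bnd _ _ _ _ T2r) cT /(bnd _ _ _ _ T2r) dT.
  apply: (@not_cross_tri i (i + leaves l) (i + leaves l + leaves r)); rewrite ?inE //; lia.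
- rewrite !inE => /(bnd _ _ _ _ T1l) aT /(bnd _ _ _ _ T1l) bT cT dT.
  by apply: not_cross aT bT _ _; move: cT dT => /=; lia.
- by move: a b c d; apply: IHl T1l T2l; lia.
- move=> /(bnd _ _ _ _ T1l) aT /(bnd _ _ _ _ T1l) bT /(bnd _ _ _ _ T2r) cT /(bnd _ _ _ _ T2r) dT.
  by apply: not_cross aT bT _ _; lia.
- rewrite !inE => /(bnd _ _ _ _ T1r) aT /(bnd _ _ _ _ T1r) bT cT dT.
  by apply: not_cross aT bT _ _; move: cT dT => /=; lia.
- move=> /(bnd _ _ _ _ T1r) aT /(bnd _ _ _ _ T1r) bT /(bnd _ _ _ _ T2l) cT /(bnd _ _ _ _ T2l) dT.
  by apply: not_cross aT bT _ _; lia.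
- by move: a b c d; apply: IHr T1r T2r; lia.
Qed.

Lemma triangulation_triangles t : m = (leaves t).+1 -> triangulation (triangles t 0).
Proof.
move=> mt; split.
- by move=> T /trianglesP[a [b [c [-> ? ? ? ?]]]]; apply: card_tri; lia.
- by rewrite card_triangles ?mt ?subSS ?subn1.
- by move=> T1 T2; apply: triangles_not_cross; rewrite mt.
Qed.

(** * Vertex sums and signs of a labelled tree *)

Variable lab : {set 'I_m} -> int.

Fixpoint labelled t i : Prop :=
  if t is Node x l r then
    let k := i + leaves l in
    [/\ lab (tri i k (k + leaves r)) = x, labelled l i & labelled r k]
  else True.

Lemma vertex_sum_triangles t i (v : 'I_m) : i + leaves t < m -> labelled t i ->
  vertex_sum (triangles t i) lab v = tree_sum t i v.
Proof.
rewrite /vertex_sum big_mkcondr.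
elim: t i => [|x l IHl r IHr] i nm; first by rewrite big_set0.
move=> [labx labl labr]; rewrite big_triangles_node // IHl //; last by move: nm => /=; lia.
rewrite IHr //; last by move: nm => /=; lia.
rewrite /= addnA labx addrA; congr (_ + _ + _)%R.
by rewrite !inE.
Qed.

Lemma twice_d_sum (T : {set {set 'I_m}}) :
  twice_d T lab = \sum_(t in T) (2 * (lab t < 0)%R + (lab t == 0%R)).
Proof.
rewrite big_split /= -big_distrr /= /twice_d; congr (2 * _ + _);
by rewrite -sum1_card (eq_bigl _ _ (in_set _)) big_mkcondr; apply: eq_bigr => t _; case: ifP.
Qed.

Lemma twice_d_node x l r i (n := leaves (Node x l r)) (k := i + leaves l) : i + n < m ->
  lab (tri i k (k + leaves r)) = x ->
  twice_d (triangles (Node x l r) i) lab =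
  2 * (x < 0)%R + (x == 0%R) + twice_d (triangles l i) lab + twice_d (triangles r k) lab.
Proof.
move=> nm labx.
rewrite !twice_d_sum -labx -addnA.
have -> : k + leaves r = i + n by rewrite /n /= addnA.
exact: (big_triangles_node (R := nat) _ nm).
Qed.

(** The modulus is 4 because d even means 2d divisible by 4. A square always adds 2: if x is
    nonzero, one of x and -x is negative, and if x is 0, two zeros add 1 each. *)
Lemma adm_tree_twice_d t e i : adm_tree t e -> i + leaves t < m -> labelled t i ->
  twice_d (triangles t i) lab = 2 * e %[mod 4].
Proof.
move=> te; elim: te i => {t e} [|x l r e1 e2 e xP _ IH1 _ IH2 ->
  |x t1 t2 t3 e1 e2 e3 e xP _ IH1 _ IH2 _ IH3 ->
  |x t1 t2 t3 e1 e2 e3 e xP _ IH1 _ IH2 _ IH3 ->] i nm.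
- by rewrite twice_d_sum big_set0.
- move=> [lx ll lr]; rewrite twice_d_node //.
  have := IH1 i _ ll; have := IH2 _ _ lr; move: nm => /= nm h1 h2.
  have {h1} := h1 ltac:(lia); have {h2} := h2 ltac:(lia).
  move: xP; rewrite !inE; case: (e1); case: (e2) => /=; lia.
- move=> [lx [lx' l1 l2] l3]; rewrite !twice_d_node //; last by move: nm => /=; lia.
  have := IH1 _ _ l1; have := IH2 _ _ l2; have := IH3 _ _ l3; move: nm => /= nm h1 h2 h3.
  have {h1} := h1 ltac:(lia); have {h2} := h2 ltac:(lia); have {h3} := h3 ltac:(lia).
  by case: (e1); case: (e2); case: (e3) => /=; lia.
- move=> [lx l1 [lx' l2 l3]]; rewrite !twice_d_node //; last by move: nm => /=; lia.
  have := IH1 _ _ l1; have := IH2 _ _ l2; have := IH3 _ _ l3; move: nm => /= nm h1 h2 h3.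
  have {h1} := h1 ltac:(lia); have {h2} := h2 ltac:(lia); have {h3} := h3 ltac:(lia).
  by case: (e1); case: (e2); case: (e3) => /=; lia.
Qed.

End Polygon.

(** * Admissibility of the triangulation of a tree *)

Section Admissible.
Variable m : nat.
Implicit Types (t : tree) (i j k v : nat) (S : {set {set 'I_m}}).
Local Notation triangles := (@triangles m).
Local Notation tri := (@tri m).

Lemma eq_labelled lab lab' t i : {in triangles t i, lab =1 lab'} ->
  labelled lab t i -> labelled lab' t i.
Proof.
elim: t i => //= x l IHl r IHr i E [lx ll lr]; split.
- by rewrite -E // setU11.
- by apply: IHl ll => T Tl; apply: E; rewrite !inE Tl orbT.
- by apply: IHr lr => T Tr; apply: E; rewrite !inE Tr !orbT.
Qed.

(** Distinct nodes give distinct triangles, so the node labels define a function on triangles. *)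
Lemma labelled_exists t i : i + leaves t < m -> exists lab : {set 'I_m} -> int, labelled lab t i.
Proof.
elim: t i => [|x l IHl r IHr] i nm; first by exists (fun=> 0%R).
have [dlr] := triangles_node (x := x) nm; rewrite inE negb_or => /andP[nl nr].
have h := leaves_gt0; have [hl hr] := (h l, h r).
have E : i + leaves (Node x l r) = i + leaves l + leaves r by rewrite /= addnA.
have [lab1 ll] := IHl i ltac:(lia); have [lab2 lr] := IHr (i + leaves l) ltac:(lia).
rewrite E in nl nr.
exists (fun T => if T == tri i (i + leaves l) (i + leaves l + leaves r) then x
  else if T \in triangles l i then lab1 T else lab2 T) => /=; split.
- by rewrite eqxx.
- apply: eq_labelled ll => T Tl; rewrite Tl ifF //.
  by apply/eqP=> Te; rewrite -Te Tl in nl.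
- apply: eq_labelled lr => T Tr; rewrite ifF; last by apply/eqP=> Te; rewrite -Te Tr in nr.
  by rewrite ifF //; apply: (disjointFl dlr).
Qed.

Variable lab : {set 'I_m} -> int.

Definition nonunit (S : {set {set 'I_m}}) := [set T in S | lab T \notin [:: 1%R; (-1)%R]].

Definition square (B : {set {set 'I_m}}) := exists T1 T2,
  [/\ B = [set T1; T2], T1 != T2, #|T1 :&: T2| = 2 & lab T1 = (- lab T2)%R].

(** This unfolds to condition (i) of [admissible], for arbitrary sets of triangles, so that it can
    be built up along the tree. *)
Definition squared S := exists P, partition P (nonunit S) /\ forall B, B \in P -> square B.

Lemma nonunitU S1 S2 : nonunit (S1 :|: S2) = nonunit S1 :|: nonunit S2.
Proof. by apply/setP=> T; rewrite !inE andb_orl. Qed.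

Lemma squaredU S1 S2 : [disjoint S1 & S2] -> squared S1 -> squared S2 -> squared (S1 :|: S2).
Proof.
move=> d12 [P [Pp Ps]] [Q [Qp Qs]]; exists (P :|: Q); split.
  rewrite nonunitU; apply: partitionUU Pp Qp _.
  by apply: disjointWl (disjointWr _ d12); apply/subsetP=> T; rewrite inE => /andP[].
by move=> B; rewrite inE => /orP[/Ps|/Qs].
Qed.

Lemma squared_unit T S : lab T \in [:: 1%R; (-1)%R] -> squared S -> squared (T |: S).
Proof.
move=> Tu [P [Pp Ps]]; exists P; split=> //.
rewrite nonunitU (_ : nonunit [set T] = set0) ?set0U //.
by apply/setP=> U; rewrite in_set in_set1 in_set0; case: eqP => // ->; rewrite Tu.
Qed.

Lemma squared_square T1 T2 S : lab T1 \notin [:: 1%R; (-1)%R] -> lab T1 = (- lab T2)%R ->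
  T1 != T2 -> #|T1 :&: T2| = 2 -> T1 \notin S -> T2 \notin S ->
  squared S -> squared (T1 |: (T2 |: S)).
Proof.
move=> T1n T12 nT cT T1S T2S [P [Pp Ps]]; exists ([set T1; T2] |: P); split.
  rewrite setUA nonunitU (_ : nonunit [set T1; T2] = [set T1; T2]).
    apply: partitionU1 => //; first by apply/set0Pn; exists T1; rewrite !inE eqxx.
    apply/pred0P=> T; rewrite /= !inE; case: eqP => [->|_]; first by rewrite (negPf T1S).
    by case: eqP => [->|//]; rewrite (negPf T2S).
  apply/setP=> T; rewrite in_set !in_set2; case: eqP => [->|_]; first by rewrite T1n.
  by case: eqP => [->|//]; move: T1n; rewrite T12 !inE; lia.
by move=> B; rewrite !inE => /orP[/eqP->|/Ps //]; exists T1, T2.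
Qed.

Lemma card_tri_share_left i l k j : i < l < k -> k < j -> j < m -> #|tri i k j :&: tri i l k| = 2.
Proof.
move=> ilk kj jm; have im : i < m by lia. have km : k < m by lia.
have -> : tri i k j :&: tri i l k = [set Ordinal im; Ordinal km].
  by apply/setP=> v; rewrite !inE -!val_eqE /=; lia.
by rewrite cards2 -val_eqE /=; lia.
Qed.

Lemma card_tri_share_right i k l j : i < k < l -> l < j -> j < m -> #|tri i k j :&: tri k l j| = 2.
Proof.
move=> ilk kj jm; have km : k < m by lia.
have -> : tri i k j :&: tri k l j = [set Ordinal km; Ordinal jm].
  by apply/setP=> v; rewrite !inE -!val_eqE /=; lia.
by rewrite cards2 -val_eqE /=; lia.
Qed.

Lemma adm_tree_squared t e i : adm_tree t e -> i + leaves t < m -> labelled lab t i ->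
  squared (triangles t i).
Proof.
have h := leaves_gt0.
move=> te; elim: te i => {t e} [|x l r e1 e2 e xP _ IH1 _ IH2 _
  |x t1 t2 t3 e1 e2 e3 e xP _ IH1 _ IH2 _ IH3 _
  |x t1 t2 t3 e1 e2 e3 e xP _ IH1 _ IH2 _ IH3 _] i nm.
- move=> _; exists set0; split; last by move=> B; rewrite inE.
  by apply/and3P; split; rewrite ?inE // /cover ?big_set0 ?/trivIset ?/cover ?big_set0 ?cards0 //;
     apply/eqP/setP=> T; rewrite !inE.
- move=> [lx ll lr]; have [dlr _] := triangles_node (x := x) nm.
  apply: squared_unit; first by rewrite lx.
  by apply: squaredU dlr (IH1 _ _ ll) (IH2 _ _ lr); move: nm => /=; lia.
- move=> /= [lx [lx' l1 l2] l3]; rewrite !addnA in lx l3.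
  have nm' : i + leaves (Node (- x)%R t1 t2) < m by move: nm => /=; lia.
  have [] := triangles_node nm; have [] := triangles_node nm'.
  rewrite /= !addnA => d12 n12 d123 n123.
  have [[h1 h2] h3] := (h t1, h t2, h t3).
  rewrite /= in nm; rewrite -setUA; apply: squared_square.
  + by rewrite lx.
  + by rewrite lx lx' opprK.
  + apply: contraNneq n123 => ->; rewrite !inE eqxx //.
  + by apply: card_tri_share_left; lia.
  + by apply: contra n123; rewrite !inE => /orP[->|->]; rewrite ?orbT.
  + rewrite inE negb_or n12 /=; apply/negP=> T2.
    by move: d123; rewrite disjoint_sym => /disjointFr/(_ T2); rewrite !inE eqxx.
  + apply: squaredU; last by apply: IH3 => //; lia.
      apply: disjointWl d123; exact: subsetUr.
    by apply: squaredU => //; [apply: IH1|apply: IH2] => //; lia.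
- move=> /= [lx l1 [lx' l2 l3]]; rewrite !addnA in lx.
  have nm' : (i + leaves t1) + leaves (Node (- x)%R t2 t3) < m by move: nm => /=; lia.
  have [] := triangles_node nm; have [] := triangles_node nm'.
  rewrite /= !addnA => d23 n23 d123 n123.
  have [[h1 h2] h3] := (h t1, h t2, h t3).
  rewrite /= in nm; rewrite [triangles t1 i :|: _]setUCA; apply: squared_square.
  + by rewrite lx.
  + by rewrite lx lx' opprK.
  + by apply: contraNneq n123 => ->; rewrite !inE eqxx !orbT.
  + by apply: card_tri_share_right; lia.
  + by apply: contra n123; rewrite !inE => /or3P[] ->; rewrite ?orbT.
  + rewrite inE negb_or n23 andbT; apply/negP=> T2.
    by move: d123 => /disjointFr/(_ T2); rewrite !inE eqxx.
  + apply: squaredU; first by apply: disjointWr d123; exact: subsetUr.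
      by apply: IH1 => //; lia.
    by apply: squaredU => //; [apply: IH2|apply: IH3] => //; lia.
Qed.

Lemma admissible_triangles t : m = (leaves t).+1 -> adm_tree t false -> labelled lab t 0 ->
  admissible (triangles t 0) lab.
Proof.
move=> mt ta tl; have nm : 0 + leaves t < m by rewrite mt.
split; first exact: adm_tree_squared ta nm tl.
have := adm_tree_twice_d ta nm tl; rewrite /sign_defined /labelling_sign muln0 mod0n.
(* As [twice_d] is divisible by 4, its half is even. *)
move=> td; have [q ->] : exists q, twice_d (triangles t 0) lab = (q.*2).*2.
  by exists (twice_d (triangles t 0) lab %/ 4); lia.
by rewrite odd_double doubleK -mul2n mulnC exprM sqrr_sign.
Qed.

End Admissible.

(** * The tree of a triangulation *)

Section Middle.
Variable m : nat.
Implicit Types (t : tree) (i j k : nat) (S : {set {set 'I_m}}).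
Local Notation tri := (@tri m).

Lemma card3_tri (T : {set 'I_m}) : #|T| = 3 ->
  exists a b c, [/\ T = tri a b c, a < b, b < c & c < m].
Proof.
move=> T3; pose s := sort leq [seq val v | v <- enum T].
have memT v : (v \in T) = ((v : nat) \in s).
  by rewrite mem_sort (mem_map val_inj) mem_enum.
have ss : sorted leq s by exact: (sort_sorted leq_total).
have us : uniq s by rewrite sort_uniq (map_inj_uniq val_inj) enum_uniq.
have sz : size s = 3 by rewrite size_sort size_map -cardE.
have sm v : v \in s -> v < m by rewrite mem_sort => /mapP[w _ ->]; exact: ltn_ord.
case: s sz ss us memT sm => [|a [|b [|c []]]] //= _ ss us memT sm.
exists a, b, c; split.
- by apply/setP=> v; rewrite memT [RHS]inE.
- by move: ss us; rewrite !inE; lia.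
- by move: ss us; rewrite !inE; lia.
- by apply: sm; rewrite !inE eqxx !orbT.
Qed.

(** The default 0 concerns sets without an inner element; triangles always have one. *)
Definition middle (T : {set 'I_m}) : nat :=
  if [pick v in T | [exists u in T, u < v] && [exists w in T, v < w]] is Some v then v else 0.

Lemma middle_tri a b c : a < b < c -> c < m -> middle (tri a b c) = b.
Proof.
move=> abc cm; have am : a < m by lia. have bm : b < m by lia.
rewrite /middle; case: pickP => [v /andP[vT /andP[/exists_inP[u uT uv] /exists_inP[w wT vw]]]|].
  by move: vT uT wT; rewrite !inE; lia.
move=> /(_ (Ordinal bm)) /negP[]; rewrite !inE eqxx orbT /=.
by apply/andP; split; apply/exists_inP; [exists (Ordinal am)|exists (Ordinal cm)];
  rewrite ?inE /= ?eqxx ?orbT //; lia.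
Qed.

Variables (TT : {set {set 'I_m}}) (triTT : triangulation TT).

Definition tri_in a b c := [/\ a < b, b < c, c < m & tri a b c \in TT].

Lemma tri_inP T : T \in TT -> exists a b c, T = tri a b c /\ tri_in a b c.
Proof.
case: triTT => T3 _ _ TT'; have [a [b [c [Te ? ? ?]]]] := card3_tri (T3 T TT').
by exists a, b, c; split; rewrite // /tri_in -Te.
Qed.

Lemma tri_in_cross a b c a' b' c' x y z w : tri_in a b c -> tri_in a' b' c' ->
  x \in [:: a; b; c] -> y \in [:: a; b; c] -> z \in [:: a'; b'; c'] -> w \in [:: a'; b'; c'] ->
  x < z -> z < y -> y < w -> False.
Proof.
move=> [? ? ? T1] [? ? ? T2]; case: triTT => _ _ nc xT yT zT wT xz zy yw.
have wm : w < m by move: wT; rewrite !inE; lia.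
have ym := ltn_trans yw wm; have zm := ltn_trans zy ym; have xm := ltn_trans xz zm.
have /negP[] := nc _ _ T1 T2 (Ordinal xm) (Ordinal ym) (Ordinal zm) (Ordinal wm)
  ltac:(by rewrite inE) ltac:(by rewrite inE) ltac:(by rewrite inE) ltac:(by rewrite inE).
by rewrite /chords_cross !inE -!val_eqE /=; lia.
Qed.

Local Ltac mem3 := by rewrite !inE ?eqxx ?orbT.

(** If a < a', the sides {a, b} and {a', c'} cross, since a < a' < b < c'; the other cases are
    alike. *)
Lemma tri_in_middle a b c a' c' : tri_in a b c -> tri_in a' b c' -> a = a' /\ c = c'.
Proof.
move=> t1 t2; have [ab bc _ _] := t1; have [ab' bc' _ _] := t2.
split.
  case: (ltngtP a a') => // aa; exfalso.
    by apply: (tri_in_cross t1 t2 (x := a) (y := b) (z := a') (w := c')); first [mem3|lia].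
  by apply: (tri_in_cross t2 t1 (x := a') (y := b) (z := a) (w := c)); first [mem3|lia].
case: (ltngtP c c') => // cc; exfalso.
  by apply: (tri_in_cross t1 t2 (x := a) (y := c) (z := b) (w := c')); first [mem3|lia].
by apply: (tri_in_cross t2 t1 (x := a') (y := c') (z := b) (w := c)); first [mem3|lia].
Qed.

Lemma tri_in_exists v : 0 < v < m.-1 -> exists a c, tri_in a v c.
Proof.
move=> vm; pose s := [seq middle T | T <- enum TT].
have us : uniq s.
  rewrite map_inj_in_uniq ?enum_uniq // => T1 T2; rewrite !mem_enum.
  move=> /tri_inP[a [b [c [-> t1]]]] /tri_inP[a' [b' [c' [-> t2]]]].
  have [? ? ? _] := t1; have [? ? ? _] := t2.
  rewrite !middle_tri; try lia; move=> bb; rewrite -{}bb in t2 *.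
  by have [-> ->] := tri_in_middle t1 t2.
have sub : {subset s <= iota 1 (m - 2)}.
  move=> _ /mapP[T + ->]; rewrite mem_enum => /tri_inP[a [b [c [-> [? ? ? _]]]]].
  by rewrite middle_tri ?mem_iota; lia.
(* The m - 2 triangles have distinct middles among the m - 2 inner vertices, so every inner vertex
   occurs. *)
have [|_ sE] := uniq_min_size us sub.
  by rewrite size_iota size_map -cardE; case: triTT => _ -> _.
have : v \in s by rewrite sE mem_iota; lia.
move=> /mapP[T]; rewrite mem_enum => /tri_inP[a [b [c [-> t1]]]] ->.
by have [? ? ? _] := t1; exists a, c; rewrite middle_tri //; lia.
Qed.

(* {i, j} is a side or a diagonal of the triangulation. *)
Definition uncrossed i j := forall a b c, tri_in a b c -> i < b < j -> i <= a /\ c <= j.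

Lemma root_exists i j : i.+1 < j -> j < m -> uncrossed i j -> exists2 k, i < k < j & tri_in i k j.
Proof.
move=> ij jm unc.
(* A triangle inside [i, j] is replaced by wider ones until it spans {i, j}; [n] bounds the missing
   width. *)
have climb n : forall a b c, tri_in a b c -> i < b < j -> (j - i) - (c - a) <= n ->
    exists2 k, i < k < j & tri_in i k j.
  elim: n => [|n IHn] a b c t1 bij dn; have [ia cj] := unc _ _ _ t1 bij; have [ab bc cm _] := t1.
    have [-> ->] : i = a /\ j = c by lia.
    by exists b => //; lia.
  have [ai|ai] := ltnP i a.
    (* The triangle with middle [a] starts before [a], and it reaches at least to [c], as its long
       side would otherwise cross a side of the current triangle. *)
    have [a' [c' t2]] : exists a' c', tri_in a' a c' by apply: tri_in_exists; lia.
    have [a'a ac' _ _] := t2.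
    have cc' : c <= c'.
      rewrite leqNgt; apply/negP=> c'c.
      case: (ltnP c' b) => bc'.
        by apply: (tri_in_cross t2 t1 (x := a') (y := c') (z := a) (w := b)); first [mem3|lia].
      by apply: (tri_in_cross t2 t1 (x := a') (y := c') (z := a) (w := c)); first [mem3|lia].
    apply: (IHn _ _ _ t2); lia.
  have [cj'|cj'] := ltnP c j; last by exists b => //; have -> : i = a by [lia]; have -> : j = c by [lia].
  have [a' [c' t2]] : exists a' c', tri_in a' c c' by apply: tri_in_exists; lia.
  have [a'a ac' _ _] := t2.
  have aa' : a' <= a.
    rewrite leqNgt; apply/negP=> a'a''.
    by apply: (tri_in_cross t1 t2 (x := a) (y := c) (z := a') (w := c')); first [mem3|lia].
  apply: (IHn _ _ _ t2); lia.
have [a [c t1]] : exists a c, tri_in a i.+1 c by apply: tri_in_exists; lia.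
by apply: climb t1 _ (leqnn _); lia.
Qed.

Lemma uncrossed_split i k j : tri_in i k j -> uncrossed i j -> uncrossed i k /\ uncrossed k j.
Proof.
move=> t1 unc; have [ik kj jm _] := t1; split=> a b c t2 bP.
  have [ia cj] := unc _ _ _ t2 ltac:(lia); split=> //; have [ab bc _ _] := t2.
  rewrite leqNgt; apply/negP=> ck.
  by apply: (tri_in_cross t1 t2 (x := i) (y := k) (z := b) (w := c)); first [mem3|lia].
have [ia cj] := unc _ _ _ t2 ltac:(lia); split=> //; have [ab bc _ _] := t2.
rewrite leqNgt; apply/negP=> ck.
by apply: (tri_in_cross t2 t1 (x := a) (y := b) (z := k) (w := j)); first [mem3|lia].
Qed.

Definition between i j := [set T in TT | [forall v in T, i <= v <= j]].

Lemma betweenP i j T : reflect (exists a b c, [/\ T = tri a b c, tri_in a b c, i <= a & c <= j])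
  (T \in between i j).
Proof.
rewrite inE; apply: (iffP andP) => [[TTT /forall_inP Tij]|[a [b [c [-> [? ? cm abcT] ? ?]]]]].
  have [a [b [c [Te t1]]]] := tri_inP TTT; have [ab bc cm _] := t1.
  have am : a < m by lia.
  have := Tij (Ordinal am); have := Tij (Ordinal cm).
  rewrite Te !inE !eqxx !orbT => /(_ isT) cj /(_ isT) ai.
  by exists a, b, c; split => //; move: cj ai => /=; lia.
by split=> //; apply/forall_inP=> v; rewrite !inE; lia.
Qed.

Lemma between_side i : between i i.+1 = set0.
Proof. by apply/setP=> T; rewrite in_set0; apply/betweenP=> -[a [b [c [_ [? ? _ _] ? ?]]]]; lia. Qed.

(** The middle vertex decides: below [k] the triangle lies in [i, k], above [k] in [k, j], and only
    the root has middle [k]. *)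
Lemma between_root i k j : tri_in i k j -> uncrossed i j ->
  between i j = tri i k j |: (between i k :|: between k j).
Proof.
move=> t1 unc; have [ik kj jm tT] := t1; have [uncl uncr] := uncrossed_split t1 unc.
apply/setP=> T; rewrite in_setU in_set1 in_setU; apply/betweenP/or3P.
  move=> [a [b [c [-> t2 ia cj]]]]; have [ab bc cm _] := t2.
  case: (ltngtP b k) => bk.
  - by apply: Or32; apply/betweenP; exists a, b, c; have [] := uncl _ _ _ t2 ltac:(lia).
  - by apply: Or33; apply/betweenP; exists a, b, c; have [] := uncr _ _ _ t2 ltac:(lia).
  - by apply: Or31; subst b; have [-> ->] := tri_in_middle t1 t2.
case=> [/eqP->|/betweenP|/betweenP].
- by exists i, k, j.
- by move=> [a [b [c [-> t2 ? ?]]]]; exists a, b, c; split=> //; lia.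
- by move=> [a [b [c [-> t2 ? ?]]]]; exists a, b, c; split=> //; lia.
Qed.

(** * Squares and the recursive construction of the tree *)

Variables (lab : {set 'I_m} -> int) (sqTT : squared lab TT).

(** A partition into pairs becomes a symmetric, single-valued relation, which is easier to restrict
    to subpolygons. *)
Lemma squared_partner : exists partner : {set 'I_m} -> {set 'I_m} -> Prop,
  [/\ forall T, T \in TT -> lab T \notin [:: 1%R; (-1)%R] -> exists T', partner T T',
      forall T T', partner T T' -> partner T' T,
      forall T T' T'', partner T T' -> partner T T'' -> T' = T''
    & forall T T', partner T T' -> [/\ T \in TT, T != T', lab T \notin [:: 1%R; (-1)%R],
        lab T' = (- lab T)%R & #|T :&: T'| = 2]].
Proof.
have [P [/and3P[/eqP cP tP _] Ps]] := sqTT.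
exists (fun T T' => [set T; T'] \in P /\ T != T'); split.
- move=> T TTT Tn; have : T \in cover P by rewrite cP inE TTT.
  move=> /bigcupP[B BP TB]; have [T1 [T2 [Be nT _ _]]] := Ps B BP.
  move: BP TB; rewrite {}Be !inE => BP /orP[] /eqP->; first by exists T2.
  by exists T1; rewrite setUC eq_sym.
- by move=> T T'; rewrite setUC eq_sym.
- move=> T T' T'' [TP nT] [TP' nT'].
  have := trivIsetP tP _ _ TP TP'; case: eqP => [E _|_ /(_ isT) /pred0P/(_ T)]; last first.
    by rewrite /= !inE eqxx.
  have : T' \in [set T; T''] by rewrite -E !inE eqxx orbT.
  by rewrite !inE eq_sym (negPf nT) => /eqP.
- move=> T T' [TP nT]; have [T1 [T2 [Be nT12 T2c T12]]] := Ps _ TP.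
  have : T \in cover P by apply/bigcupP; exists [set T; T'] => //; rewrite !inE eqxx.
  rewrite cP inE => /andP[TTT Tn]; split => //.
    have : T \in [set T1; T2] by rewrite -Be !inE eqxx.
    have : T' \in [set T1; T2] by rewrite -Be !inE eqxx orbT.
    rewrite !inE => /orP[] /eqP E /orP[] /eqP E'; subst => //; rewrite ?eqxx // in nT.
    by rewrite T12 opprK.
  have : T \in [set T1; T2] by rewrite -Be !inE eqxx.
  have : T' \in [set T1; T2] by rewrite -Be !inE eqxx orbT.
  rewrite !inE => /orP[] /eqP E /orP[] /eqP E'; subst => //; rewrite ?eqxx // in nT.
  by rewrite setIC.
Qed.

Lemma share_tri a b c a' b' c' : #|tri a b c :&: tri a' b' c'| = 2 ->
  exists x y, [/\ x < y, x \in [:: a; b; c], y \in [:: a; b; c], x \in [:: a'; b'; c']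
    & y \in [:: a'; b'; c']].
Proof.
move/eqP/cards2P=> [x [y [nxy E]]].
have : x \in tri a b c :&: tri a' b' c' by rewrite E !inE eqxx.
have : y \in tri a b c :&: tri a' b' c' by rewrite E !inE eqxx orbT.
rewrite !in_setI ![_ \in tri _ _ _]inE => /andP[y1 y2] /andP[x1 x2].
have := nxy; rewrite -val_eqE /= neq_ltn => /orP[xy|xy]; first by exists x, y.
by exists y, x.
Qed.

Definition codes t i j := [/\ i + leaves t = j, triangles m t i = between i j & labelled lab t i].

Lemma codes_node i k j tl tr (x := lab (tri i k j)) : tri_in i k j -> uncrossed i j ->
  codes tl i k -> codes tr k j -> codes (Node x tl tr) i j.
Proof.
move=> t1 unc [Ek Tl ll] [Ej Tr lr].
by split; rewrite /= ?addnA ?Ek ?Ej // Tl Tr -between_root.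
Qed.

Lemma between_sub i j i' j' : i' <= i -> j <= j' -> between i j \subset between i' j'.
Proof.
move=> ii jj; apply/subsetP=> T /betweenP[a [b [c [-> t1 ? ?]]]].
by apply/betweenP; exists a, b, c; split=> //; lia.
Qed.

Variable partner : {set 'I_m} -> {set 'I_m} -> Prop.
Hypotheses (partner_ex : forall T, T \in TT -> lab T \notin [:: 1%R; (-1)%R] ->
    exists T', partner T T')
  (partner_sym : forall T T', partner T T' -> partner T' T)
  (partner_uniq : forall T T' T'', partner T T' -> partner T T'' -> T' = T'')
  (partnerP : forall T T', partner T T' -> [/\ T \in TT, T != T',
     lab T \notin [:: 1%R; (-1)%R], lab T' = (- lab T)%R & #|T :&: T'| = 2]).

(** The two polygons share at most one vertex, whereas partners share two. *)
Lemma partner_sep i j j' k T T' : j <= j' -> T \in between i j -> T' \in between j' k ->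
  ~ partner T T'.
Proof.
move=> jj' /betweenP[a [b [c [-> [? ? ? _] ? ?]]]] /betweenP[a' [b' [c' [-> [? ? ? _] ? ?]]]].
by move=> /partnerP[_ _ _ _ /share_tri[x [y []]]]; rewrite !inE; lia.
Qed.

Definition partners_in (S1 S2 : {set {set 'I_m}}) :=
  forall T T', partner T T' -> T \in S1 -> T' \in S2.

(** A partner of a triangle in [S] is not the root by assumption, and it is not right of [k] by
    [partner_sep]. *)
Lemma partners_in_left i k j S : tri_in i k j -> uncrossed i j -> S \subset between i k ->
  partners_in S (between i j) -> (forall T, partner (tri i k j) T -> T \notin S) ->
  partners_in S (between i k).
Proof.
move=> t1 unc /subsetP Ssub Sin rootS T T' TT' TS; have := Sin _ _ TT' TS.
rewrite (between_root t1 unc) in_setU in_set1 in_setU => /or3P[/eqP T'e|//|T'r].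
  by have := rootS T; rewrite -T'e TS => /(_ (partner_sym TT')).
by case: (partner_sep (leqnn _) (Ssub _ TS) T'r TT').
Qed.

Lemma partners_in_right i k j S : tri_in i k j -> uncrossed i j -> S \subset between k j ->
  partners_in S (between i j) -> (forall T, partner (tri i k j) T -> T \notin S) ->
  partners_in S (between k j).
Proof.
move=> t1 unc /subsetP Ssub Sin rootS T T' TT' TS; have := Sin _ _ TT' TS.
rewrite (between_root t1 unc) in_setU in_set1 in_setU => /or3P[/eqP T'e|T'l|//].
  by have := rootS T; rewrite -T'e TS => /(_ (partner_sym TT')).
by case: (partner_sep (leqnn _) T'l (Ssub _ TS) (partner_sym TT')).
Qed.

Lemma partners_inW S1 S2 S1' S2' : S1' \subset S1 -> S2 \subset S2' ->
  partners_in S1 S2 -> partners_in S1' S2'.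
Proof. by move=> /subsetP s1 /subsetP s2 S12 T T' TT' /s1/(S12 _ _ TT')/s2. Qed.

Lemma between_tri_notin i j a b c : a < b < c -> c < m -> (a < i) || (j < c) ->
  tri a b c \notin between i j.
Proof.
by move=> abc cm out; apply/betweenP=> -[a' [b' [c' [E [? ? ? _] ? ?]]]]; have [] := tri_inj _ _ _ _ E; lia.
Qed.

Local Ltac order_lia := repeat match goal with
  | H : is_true (in_mem _ _) |- _ => clear H
  | H : is_true (~~ in_mem _ _) |- _ => clear H
  | H : #|_| = _ |- _ => clear H
  end; lia.

Lemma uncrossed_codes i j : i < j -> j < m -> uncrossed i j ->
  partners_in (between i j) (between i j) -> exists t e, codes t i j /\ adm_tree t e.
Proof.
move: {2}(j - i) (leqnn (j - i)) => n.
elim: n i j => [|n IHn] i j jin ij jm unc sq; first order_lia.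
have [ij1|ij1] := ltnP i.+1 j; last first.
  have -> : j = i.+1 by order_lia.
  exists Leaf, false; split; last exact: AdmLeaf.
  by split; rewrite /= ?addn1 ?between_side.
have [k ikj t1] := root_exists ij1 jm unc; have [_ _ _ rootTT] := t1.
have [uncl uncr] := uncrossed_split t1 unc.
have subl : between i k \subset between i j by apply: between_sub; order_lia.
have subr : between k j \subset between i j by apply: between_sub; order_lia.
have [ru|rn] := boolP (lab (tri i k j) \in [:: 1%R; (-1)%R]).
  have rootS S T : partner (tri i k j) T -> T \notin S by case/partnerP=> _ _; rewrite ru.
  have [||||tl [e1 [rl al]]] := IHn i k _ _ _ uncl; try order_lia.
    exact: partners_in_left t1 unc (subxx _) (partners_inW subl (subxx _) sq) (rootS _).
  have [||||tr [e2 [rr ar]]] := IHn k j _ _ _ uncr; try order_lia.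
    exact: partners_in_right t1 unc (subxx _) (partners_inW subr (subxx _) sq) (rootS _).
  exists (Node (lab (tri i k j)) tl tr), (e1 (+) e2 (+) (lab (tri i k j) == (-1)%R)).
  by split; [exact: codes_node | apply: AdmNode al ar erefl].
(* The root belongs to a square, whose other triangle [T2] lies in [i, k] or in [k, j]. *)
have [T2 p2] := partner_ex rootTT rn; have [_ nT2 _ lab2 share] := partnerP p2.
have rooti : tri i k j \in between i j by rewrite (between_root t1 unc) setU11.
have := sq _ _ p2 rooti; rewrite (between_root t1 unc) in_setU in_set1 eq_sym (negPf nT2) /=.
have rootS S : T2 \notin S -> forall T, partner (tri i k j) T -> T \notin S.
  by move=> nS T /(partner_uniq p2) <-.
rewrite in_setU => /orP[T2b|T2b].
  have [a [l [c [Te t2 ia ck]]]] := betweenP _ _ _ T2b; have [al lc _ _] := t2.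
  rewrite {}Te in p2 nT2 lab2 share T2b rootS.
  (* Inside [i, k] the only vertices of the root are [i] and [k], so [T2] contains both and is the
     root triangle of the left subpolygon. *)
  have [Ea Ec] : a = i /\ c = k by have [x [y []]] := share_tri share; rewrite !inE; lia.
  move: Ea Ec => {ia ck} Ea Ec; subst a c.
  have [uncll unclr] := uncrossed_split t2 uncl.
  (* A smaller interval misses [i] or [k], hence does not contain [T2], so no triangle in it is the
     partner of the root. *)
  have down i' j' : i <= i' -> j' <= k -> (i < i') || (j' < k) ->
      partners_in (between i' j') (between i k).
    move=> ii jk out.
    have sub : between i' j' \subset between i k by exact: between_sub.
    apply: (partners_in_left t1 unc sub).
      exact: partners_inW (subset_trans sub subl) (subxx _) sq.
    by apply: rootS; apply: between_tri_notin; order_lia.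
  (* The partner of [T2] is the root, whose vertex [j] lies beyond [k]. *)
  have rootS2 i' j' : j' <= k -> forall T, partner (tri i l k) T -> T \notin between i' j'.
    move=> jk T /(partner_uniq (partner_sym p2)) <-; apply: between_tri_notin; order_lia.
  have [||||A [e1 [r1 a1]]] := IHn i l _ _ _ uncll; try order_lia.
    by apply: (partners_in_left t2 uncl (subxx _) _ (rootS2 _ _ _)); [apply: down|]; order_lia.
  have [||||B [e2 [r2 a2]]] := IHn l k _ _ _ unclr; try order_lia.
    by apply: (partners_in_right t2 uncl (subxx _) _ (rootS2 _ _ _)); [apply: down|]; order_lia.
  have [||||C [e3 [r3 a3]]] := IHn k j _ _ _ uncr; try order_lia.
    apply: (partners_in_right t1 unc (subxx _) (partners_inW subr (subxx _) sq) _).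
    by apply: rootS; apply: between_tri_notin; order_lia.
  have := codes_node t1 unc (codes_node t2 uncl r1 r2) r3; rewrite lab2 => r.
  by exists (Node (lab (tri i k j)) (Node (- lab (tri i k j))%R A B) C), (~~ (e1 (+) e2 (+) e3));
    split=> //; apply: AdmSquareL rn a1 a2 a3 erefl.
have [a [l [c [Te t2 ia ck]]]] := betweenP _ _ _ T2b; have [al lc _ _] := t2.
rewrite {}Te in p2 nT2 lab2 share T2b rootS.
have [Ea Ec] : a = k /\ c = j by have [x [y []]] := share_tri share; rewrite !inE; lia.
move: Ea Ec => {ia ck} Ea Ec; subst a c.
have [uncrl uncrr] := uncrossed_split t2 uncr.
have down i' j' : k <= i' -> j' <= j -> (k < i') || (j' < j) ->
    partners_in (between i' j') (between k j).
  move=> ii jk out.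
    have sub : between i' j' \subset between k j by exact: between_sub.
  apply: (partners_in_right t1 unc sub).
    exact: partners_inW (subset_trans sub subr) (subxx _) sq.
  by apply: rootS; apply: between_tri_notin; order_lia.
have rootS2 i' j' : k <= i' -> forall T, partner (tri k l j) T -> T \notin between i' j'.
  by move=> ki T /(partner_uniq (partner_sym p2)) <-; apply: between_tri_notin; order_lia.
have [||||A [e1 [r1 a1]]] := IHn i k _ _ _ uncl; try order_lia.
  apply: (partners_in_left t1 unc (subxx _) (partners_inW subl (subxx _) sq) _).
  by apply: rootS; apply: between_tri_notin; order_lia.
have [||||B [e2 [r2 a2]]] := IHn k l _ _ _ uncrl; try order_lia.
  by apply: (partners_in_left t2 uncr (subxx _) _ (rootS2 _ _ _)); [apply: down|]; order_lia.
have [||||C [e3 [r3 a3]]] := IHn l j _ _ _ uncrr; try order_lia.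
  by apply: (partners_in_right t2 uncr (subxx _) _ (rootS2 _ _ _)); [apply: down|]; order_lia.
have := codes_node t1 unc r1 (codes_node t2 uncr r2 r3); rewrite lab2 => r.
by exists (Node (lab (tri i k j)) A (Node (- lab (tri i k j))%R B C)), (~~ (e1 (+) e2 (+) e3));
  split=> //; apply: AdmSquareR rn a1 a2 a3 erefl.
Qed.

(** The side {0, m - 1} has the whole polygon on one side, so both closure conditions hold at
    once. *)
Lemma codes_full : 2 <= m -> exists t e, codes t 0 m.-1 /\ adm_tree t e.
Proof.
move=> m2; apply: uncrossed_codes; try lia.
  by move=> a b c [? ? ? _] _; lia.
move=> T T' /partner_sym/partnerP[/tri_inP[a [b [c [-> t1]]]] _ _ _ _] _.
by apply/betweenP; exists a, b, c; split=> //; case: t1; lia.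
Qed.

Lemma between_full : between 0 m.-1 = TT.
Proof.
apply/setP=> T; rewrite inE; apply: andb_idr => _.
by apply/forall_inP=> v _; have := ltn_ord v; lia.
Qed.

End Middle.

Theorem theorem7p3 :
  (forall (m : nat) (T : {set {set 'I_m}}) (a : {set 'I_m} -> int),
      (2 <= m)%N -> triangulation T -> admissible T a ->
      quiddity_cycle (vertex_sum T a))
  /\
  (forall (m : nat) (c : 'I_m -> int),
      quiddity_cycle c ->
      exists (T : {set {set 'I_m}}) (a : {set 'I_m} -> int),
        [/\ triangulation T, admissible T a & forall i, c i = vertex_sum T a i]).
Proof.
split=> [m TT lab m2 triTT [sqTT [sd sgn]]|m c cq].
  have [partner [pex psym puniq pP]] := squared_partner sqTT.
  have [t [e [[Et Tt lt] ta]]] := codes_full triTT pex psym puniq pP m2.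
  rewrite between_full in Tt; rewrite add0n in Et.
  have nm : 0 + leaves t < m by lia.
  have e0 : e = false.
    have := adm_tree_twice_d ta nm lt; rewrite Tt => td.
    (* Otherwise [twice_d] would be 2 modulo 4, its half odd and the sign -1. *)
    apply/negP=> et; rewrite et in td; move: sgn; rewrite /labelling_sign.
    rewrite -signr_odd (_ : odd _ = true) //; move: sd; rewrite /sign_defined; lia.
  have Em : m = (leaves t).+1 by lia.
  rewrite /quiddity_cycle; subst m.
  transitivity (\prod_(v < (leaves t).+1) eta (tree_sum t 0 (v + 0)))%R.
    by apply: eq_bigr => v _; rewrite -Tt (vertex_sum_triangles v nm lt) addn0.
  by rewrite prod_eta (adm_tree_path_mx 0 ta) e0 expr0 mul1r eta0_sq.
(* For m = 0 the empty product is I, not -I; the case m = 1 is refuted inside [quiddity_tree]. *)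
have [m0|m0] := posnP m.
  by subst m; move: cq; rewrite /quiddity_cycle big_ord0 => /matrixP/(_ 0%R 0%R); rewrite !mxE.
pose s := [seq c i | i <- enum 'I_m].
have sz : size s = m by rewrite size_map size_enum_ord.
have [||t [ta Et tE]] := @quiddity_tree s false; rewrite ?sz //.
  by rewrite big_map enumT expr0; exact: cq.
rewrite sz in Et tE; have nm : 0 + leaves t < m by rewrite Et.
have [lab tl] := labelled_exists nm.
exists (triangles m t 0), lab; split.
- exact: triangulation_triangles.
- exact: admissible_triangles.
- move=> i; rewrite (vertex_sum_triangles i nm tl) -tE // (nth_map i) ?size_enum_ord //.
  by rewrite nth_ord_enum.
Qed.
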